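(* For any $C>0$, there exist $\alpha_0\in(0,1)$ and positive integers $a_1,a_2,a_3$ such that the following holds. Let $0<\alpha<\alpha_0$ and $P=\{0,a_1,a_2,a_3\}$. For all sufficiently large $N$, there exists $A\subseteq[N]$ with $|A|\ge\alpha N$ such that for all nonzero integers $d$, there are at most $\alpha^CN$ points $x\in\mathbb{Z}$ with $x+d\cdot P\subseteq A$.
   Context: $[N]=\{1,\dots,N\}$ and $x+d\cdot P=\{x+dt:t\in P\}$. *)

(* Defs.v *)
From HB Require Import structures.
From mathcomp Require Import all_boot all_order all_algebra.
From mathcomp Require Import finmap.
From mathcomp Require Import all_classical all_reals all_analysis.

Set Implicit Arguments.
Unset Strict Implicit.
Unset Printing Implicit Defensive.

Import Order.TTheory GRing.Theory Num.Theory.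
Import numFieldNormedType.Exports.

Local Open Scope classical_set_scope.
Local Open Scope ring_scope.

Definition int_range (N : nat) : set int := [set n : int | 1 <= n <= N%:Z].

Definition affine_copy (x d : int) (P : set int) : set int :=
  [set x + d * t | t in P].

(* [fset_set S] is empty when [S] is infinite, so finiteness is required
   explicitly in the upper bound on the size. *)
Definition card_at_most (R : realType) (S : set int) (r : R) : Prop :=
  finite_set S /\ (#|` fset_set S|)%:R <= r.

(* Main.v *)
Require Import Defs.
From HB Require Import structures.
From mathcomp Require Import all_boot all_order all_algebra.
From mathcomp Require Import finmap.
From mathcomp Require Import all_classical all_reals all_analysis.
From mathcomp Require Import zify ring lra.

Set Implicit Arguments.
Unset Strict Implicit.
Unset Printing Implicit Defensive.

Import Order.TTheory GRing.Theory Num.Theory.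
Import numFieldNormedType.Exports.

Local Open Scope classical_set_scope.
Local Open Scope ring_scope.

(** Take r odd, K = (r^2 + 1) / 2 and P = {0, r - 1, 2 r, r (r + 1)}.  If y2, y1,
    y0, y3 are the values of a quadratic polynomial at x + d * P (in this order),
    then K (y0 - 2 y1 + y2) = y3 - y1.  There are sets of integers below M, of
    size M^(1 - eps) with eps -> 0 as K grows, in which this relation has only
    constant solutions.  At one scale, use the numbers X(K) where X is a
    polynomial of degree < s with small digits: the relation lifts to
    t (X0 - 2 X1 + X2) = X3 - X1, which at t = -k says that X1(-k) is a weighted
    average of the other values, so a Behrend-type sphere in the values X(-1),
    ..., X(-s) excludes nonconstant solutions.  Then iterate over digits in a
    larger base.

    Fatten such a set to a subset S of Z/mZ and let A be the set of x <= N such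
    that x^2, suitably translated, lies in S modulo m, for both m = N and
    m = N + 1.  A copy x + d * P in A forces (x + a1 d)^2 - x^2, which is linear
    in x, into a short arc modulo m; this is rare as soon as gcd(d, m) is
    O(sqrt N), which holds for one of the two coprime moduli. *)

(** * The linear relation, pigeonhole and uniqueness of digits *)

Definition quad_rel (K : nat) (x0 x1 x2 x3 : int) : Prop :=
  K%:Z * (x0 - 2 * x1 + x2) = x3 - x1.

(** Sets are encoded as indexed families. Triviality is asked of the indices, so it forces
    injectivity and [#|T|] is the size of the set. *)
Definition only_trivial (K : nat) (T : finType) (f : T -> nat) : Prop :=
  forall t0 t1 t2 t3 : T, quad_rel K (f t0) (f t1) (f t2) (f t3) ->
  [/\ t0 = t1, t2 = t1 & t3 = t1].

Lemma only_trivial_inj K (T : finType) (f : T -> nat) :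
  only_trivial K f -> injective f.
Proof.
move=> fK t t' ftt'; have [] := fK t t' t' t' => //.
by rewrite /quad_rel ftt'; ring.
Qed.

Lemma pigeonhole_fiber (T V : finType) (f : T -> V) : (0 < #|T|)%N ->
  exists v, (#|T| <= #|[set x | f x == v]%SET| * #|V|)%N.
Proof.
move=> /card_gt0P[t _].
have sumT : #|T| = (\sum_v #|[set x | f x == v]%SET|)%N.
  rewrite -sum1_card (partition_big f xpredT) //=; apply: eq_bigr => v _.
  by rewrite -sum1_card; apply: eq_bigl => x; rewrite inE.
have [v _ vmax] := @arg_maxnP V (f t) xpredT
  (fun v => #|[set x | f x == v]%SET|) isT.
exists v; rewrite sumT mulnC -sum_nat_const.
by apply: leq_sum => u _; exact: vmax.
Qed.

Lemma small_multiple_eq0 (k a c : int) : a * k + c = 0 -> `|c| < k ->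
  a = 0 /\ c = 0.
Proof.
move=> akc ck; have [a_gt0|a_lt0|a0] := ltgtP 0 a; last by split; nia.
- have : k <= a * k by nia.
  by lia.
- have : k <= (- a) * k by nia.
  by lia.
Qed.

(** Modulo [K] only the constant coefficient survives, so it is zero; divide by [K] and repeat. This
    lifts relations between values at [K] to polynomial identities. *)
Lemma small_coef_eq0 (K : nat) (p : {poly int}) :
  (forall i, `|p`_i| < K%:Z) -> p.[K%:Z] = 0 -> p = 0.
Proof.
elim/poly_ind: p => [//|p c IHp] small.
rewrite hornerMXaddC => /small_multiple_eq0 [].
  by have := small 0%N; rewrite coefD coefMX coefC /= add0r.
move=> pK0 c0; rewrite c0 polyC0 addr0 IHp ?mul0r // => i.
by have := small i.+1; rewrite coefD coefMX coefC /= addr0.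
Qed.

(** * Polynomials with small digits *)

Definition digit_poly (s L : nat) (X : {ffun 'I_s -> 'I_L}) : {poly int} :=
  \sum_(j < s) (X j)%:Z *: 'X^j.

Lemma coef_digit_poly s L (X : {ffun 'I_s -> 'I_L}) (j : 'I_s) :
  (digit_poly X)`_j = X j.
Proof.
rewrite coef_sum (bigD1 j) //= coefZ coefXn eqxx mulr1 big1 ?addr0 // => i ij.
by rewrite coefZ coefXn eq_sym (negbTE (ij : val i != val j)) mulr0.
Qed.

Lemma size_digit_poly s L (X : {ffun 'I_s -> 'I_L}) :
  (size (digit_poly X) <= s)%N.
Proof.
apply: (leq_trans (size_sum _ _ _)); apply/bigmax_leqP => j _.
by rewrite (leq_trans (size_scale_leq _ _)) // size_polyXn ltn_ord.
Qed.

Lemma digit_poly_inj s L : injective (@digit_poly s L).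
Proof.
move=> X Y XY; apply/ffunP => j; apply/val_inj.
by have := coef_digit_poly X j; rewrite XY coef_digit_poly => -[].
Qed.

Lemma digit_poly_bound s L (X : {ffun 'I_s -> 'I_L}) i :
  0 <= (digit_poly X)`_i < L%:Z \/ (digit_poly X)`_i = 0.
Proof.
case: (ltnP i s) => [lt_is|le_si].
  left; have := coef_digit_poly X (Ordinal lt_is) => /= ->.
  by rewrite le0z_nat ltz_nat ltn_ord.
by right; rewrite nth_default // (leq_trans (size_digit_poly X)).
Qed.

Lemma digit_poly_horner s L (X : {ffun 'I_s -> 'I_L}) (x : int) :
  (digit_poly X).[x] = \sum_(j < s) (X j)%:Z * x ^+ j.
Proof.
by rewrite horner_sum; apply: eq_bigr => j _; rewrite hornerZ hornerXn.
Qed.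

Lemma digit_value_lt s L K (X : {ffun 'I_s -> 'I_L}) : (L <= K)%N ->
  (\sum_(j < s) X j * K ^ j < K ^ s)%N.
Proof.
move=> LK; elim: s X => [|s IHs] X; first by rewrite big_ord0.
rewrite big_ord_recr /=.
have : (\sum_(j < s) X (widen_ord (leqnSn s) j) * K ^ j < K ^ s)%N.
  apply: leq_ltn_trans (IHs [ffun j => X (widen_ord (leqnSn s) j)]).
  by apply: leq_sum => j _; rewrite ffunE.
have := ltn_ord (X ord_max); rewrite expnS.
move: (\sum_(i < s) _)%N (K ^ s)%N (nat_of_ord (X ord_max)) => S E x; nia.
Qed.

Lemma digit_value_bound s L (X : {ffun 'I_s -> 'I_L}) (k : 'I_s) :
  `|(digit_poly X).[- k.+1%:Z]| <= (s ^ s.+1 * L)%:Z.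
Proof.
rewrite digit_poly_horner (le_trans (ler_norm_sum _ _ _)) //.
have -> : (s ^ s.+1 * L)%:Z = \sum_(j < s) (s ^ s * L)%:Z.
  by rewrite sumr_const card_ord expnS; lia.
apply: ler_sum => j _.
rewrite normrM normrX normrN mulrC [X in _ <= X]PoszM !ger0_norm //.
apply: ler_pM => //; last by rewrite lez_nat ltnW.
rewrite -natz -natrX natz lez_nat.
apply: (@leq_trans (s ^ j)).
  by elim: (nat_of_ord j) => // i IH; rewrite !expnS leq_mul // ltn_ord.
by rewrite leq_pexp2l ?(ltnW (ltn_ord j)) // (leq_ltn_trans _ (ltn_ord j)).
Qed.

(** * Behrend-type spheres at one scale *)

(** A weighted squared norm of the vector of values at [-1, ..., -s]. The index [k] starts at 0 and
    stands for the point [-(k + 1)], so the weight [S] used below is the absolute value of the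
    point. *)
Definition energy (s L : nat) (w : nat -> nat) (X : {ffun 'I_s -> 'I_L}) : int :=
  \sum_(k < s) (w k)%:Z * (digit_poly X).[- k.+1%:Z] ^+ 2.

Lemma energy_bound s L (w : nat -> nat) (X : {ffun 'I_s -> 'I_L}) :
  (forall k : 'I_s, (w k <= s)%N) ->
  (`|energy w X| <= s ^ (2 * s + 4) * L ^ 2)%N.
Proof.
move=> ws.
rewrite -lez_nat abszE (le_trans (ler_norm_sum _ _ _)) //.
have -> : (s ^ (2 * s + 4) * L ^ 2)%:Z =
    \sum_(j < s) s%:Z * (s ^ s.+1 * L)%:Z ^+ 2.
  transitivity (s * (s * (s ^ s.+1 * L) ^ 2))%N%:Z.
    rewrite expnMn -expnM (_ : 2 * s + 4 = (s.+1 * 2).+2)%N; last by lia.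
    by rewrite 2!expnS -!mulnA.
  by rewrite sumr_const card_ord expr2 -!PoszM -mulr_natl natz -PoszM mulnn.
apply: ler_sum => k _; rewrite normrM normrX.
apply: ler_pM; rewrite ?exprn_ge0 //; first by rewrite ger0_norm // lez_nat.
by rewrite lerXn2r ?nnegrE // digit_value_bound.
Qed.

(* At t = -k the relation reads (2k+1) X1 = k X0 + k X2 + X3, a weighted
   average, so the two energies (weights 1 and k) leave no room for
   a nonconstant solution. *)
Lemma energy_rigid s L (X0 X1 X2 X3 : {ffun 'I_s -> 'I_L}) (u v : int) :
  'X * (digit_poly X0 - 2 * digit_poly X1 + digit_poly X2)
    = digit_poly X3 - digit_poly X1 ->
  (forall X, X \in [:: X0; X1; X2; X3] ->
    energy (fun=> 1%N) X = u /\ energy S X = v) ->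
  [/\ X0 = X1, X2 = X1 & X3 = X1].
Proof.
move=> rel uv.
have [[u0 v0] [u1 v1] [u2 v2] [u3 v3]] :
  [/\ energy (fun=> 1%N) X0 = u /\ energy S X0 = v,
      energy (fun=> 1%N) X1 = u /\ energy S X1 = v,
      energy (fun=> 1%N) X2 = u /\ energy S X2 = v &
      energy (fun=> 1%N) X3 = u /\ energy S X3 = v].
  by split; apply: uv; rewrite !inE eqxx ?orbT.
pose e (X : {ffun 'I_s -> 'I_L}) k := (digit_poly X).[- k.+1%:Z].
(* Up to normalization, the variance of the three values averaged to [e X1 k]. By the identity
   between variance and second moments, its sum over [k] is a combination of energies that
   cancels. *)
pose gap k := k.+1%:Z * (e X0 k - e X1 k) ^+ 2 +
  k.+1%:Z * (e X2 k - e X1 k) ^+ 2 + (e X3 k - e X1 k) ^+ 2.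
have gap_ge0 k : 0 <= gap k.
  by apply: addr_ge0; [apply: addr_ge0; apply: mulr_ge0|]; rewrite ?sqr_ge0.
have rel_at k : - k.+1%:Z * (e X0 k - 2 * e X1 k + e X2 k) = e X3 k - e X1 k.
  by have := congr1 (horner^~ (- k.+1%:Z)) rel; rewrite !hornerE.
have sum_gap : \sum_(k < s) gap k = 0.
  transitivity (energy S X0 + energy S X2 - energy S X1 *+ 2 +
      (energy (fun=> 1%N) X3 - energy (fun=> 1%N) X1)).
    rewrite -sumrMnl -big_split /= -!sumrB -big_split /=; apply: eq_bigr => k _.
    rewrite /gap -!/(e _ _); have := rel_at k.
    move: (e X0 k) (e X1 k) (e X2 k) (e X3 k) (k.+1%:Z) => x0 x1 x2 x3 y xy.
    have -> : x3 = x1 - y * (x0 - 2 * x1 + x2) by rewrite -[X in _ + X]mulNr xy; ring.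
    by ring.
  by rewrite v0 v1 v2 u3 u1; ring.
have gap0 (k : 'I_s) : gap k = 0.
  by have /psumr_eq0P := sum_gap; apply.
(* The difference has degree below [s] and vanishes at [s] distinct points. *)
have eqX1 X : (forall k : 'I_s, e X k = e X1 k) -> X = X1.
  move=> eX; apply: digit_poly_inj; apply/eqP; rewrite -subr_eq0.
  apply: contraT => nz.
  have := @max_poly_roots _ _ [seq - (k : 'I_s).+1%:Z | k <- enum 'I_s] nz.
  rewrite size_map size_enum_ord map_inj_uniq ?enum_uniq; last first.
    by move=> i j /oppr_inj [] /val_inj.
  rewrite ltnNge (leq_trans (size_polyD _ _)) ?geq_max ?size_polyN ?size_digit_poly //.
  apply=> //; apply/allP => _ /mapP[k _ ->].
  by rewrite rootE !hornerE -!/(e _ _) eX subrr.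
have e_eq (k : 'I_s) : [/\ e X0 k = e X1 k, e X2 k = e X1 k & e X3 k = e X1 k].
  have := gap0 k; rewrite /gap.
  move: (e X0 k) (e X1 k) (e X2 k) (e X3 k) => x0 x1 x2 x3.
  have := sqr_ge0 (x0 - x1); have := sqr_ge0 (x2 - x1).
  have := sqr_ge0 (x3 - x1); move=> h3 h2 h0 hs.
  have y0 : 0 < k.+1%:Z by [].
  have z0 := mulr_ge0 (ltW y0) h0; have z2 := mulr_ge0 (ltW y0) h2.
  have sq0 x : k.+1%:Z * (x - x1) ^+ 2 = 0 -> x = x1.
    by move=> /eqP; rewrite mulf_eq0 /= sqrf_eq0 subr_eq0 => /eqP.
  split; apply: sq0; first by lra.
    by lra.
  by rewrite (_ : (x3 - x1) ^+ 2 = 0) ?mulr0 //; lra.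
by split; apply: eqX1 => k; have [] := e_eq k.
Qed.

(** The difference of the two sides has coefficients at most [3 * (L - 1)] in absolute value, hence
    below [K], and vanishes at [K]: there are no carries. *)
Lemma digit_poly_quad_rel s L K (X0 X1 X2 X3 : {ffun 'I_s -> 'I_L}) :
  (0 < L)%N -> (3 * L <= K)%N ->
  let f (X : {ffun 'I_s -> 'I_L}) : int := (digit_poly X).[K%:Z] in
  quad_rel K (f X0) (f X1) (f X2) (f X3) ->
  'X * (digit_poly X0 - 2 * digit_poly X1 + digit_poly X2)
    = digit_poly X3 - digit_poly X1.
Proof.
move=> L0 LK f rel; apply/eqP; rewrite -subr_eq0; apply/eqP.
apply: (@small_coef_eq0 K) => [i|]; last first.
  by rewrite !hornerE; move: rel; rewrite /quad_rel /f => ->; rewrite subrr.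
rewrite !(coefB, coefD, coefXM, coefMX) -polyC_natr /=.
rewrite !(coefB, coefD, coefCM, coefXM) /=.
have bd (X : {ffun 'I_s -> 'I_L}) j : 0 <= (digit_poly X)`_j < L%:Z.
  by have [//|->] := digit_poly_bound X j; rewrite lexx.
move: (bd X3 i) (bd X1 i) (bd X0 i.-1) (bd X1 i.-1) (bd X2 i.-1).
move: (digit_poly X3)`_i (digit_poly X1)`_i (digit_poly X0)`_i.-1
  (digit_poly X1)`_i.-1 (digit_poly X2)`_i.-1 => a b c d e.
by case: (i == 0%N) => *; lia.
Qed.

(** Pigeonhole over the pair of energies: there are [L ^ s] polynomials, but each energy takes only
    [O(L ^ 2)] values for fixed [s]. The loss is about [L ^ 4], with an exponent independent of
    [s]. *)
Lemma behrend_set s L K : (0 < s)%N -> (0 < L)%N -> (3 * L <= K)%N ->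
  exists (T : finType) (f : T -> nat),
  [/\ (L ^ s <= #|T| * ((s ^ (2 * s + 4)).+1 * L ^ 2) ^ 2)%N,
      forall t, (f t < K ^ s)%N & only_trivial K f].
Proof.
move=> s0 L0 LK.
pose B := (s ^ (2 * s + 4) * L ^ 2)%N.
(* By [energy_bound] both energies are at most [B], so [inord] loses nothing. *)
pose F (X : {ffun 'I_s -> 'I_L}) : 'I_B.+1 * 'I_B.+1 :=
  (inord `|energy (fun=> 1%N) X|, inord `|energy S X|).
have cardT : #|{ffun 'I_s -> 'I_L}| = (L ^ s)%N by rewrite card_ffun !card_ord.
have [|v] := @pigeonhole_fiber _ _ F; first by rewrite cardT expn_gt0 L0.
rewrite cardT card_prod card_ord => cardv.
pose code (X : {ffun 'I_s -> 'I_L}) := (\sum_(j < s) X j * K ^ j)%N.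
exists {X | F X == v}, (fun t => code (sval t)); split.
- rewrite card_sig; apply: (leq_trans cardv); rewrite cardsE leq_mul2l.
  by rewrite expnS expn1 leq_mul ?orbT // /B mulSn addnC; nia.
- by move=> t; apply: digit_value_lt; lia.
move=> [X0 v0] [X1 v1] [X2 v2] [X3 v3] /=.
have codeE X : (code X)%:Z = (digit_poly X).[K%:Z].
  rewrite digit_poly_horner -natz natr_sum; apply: eq_bigr => j _.
  by rewrite natrM natrX !natz.
rewrite !codeE => /(digit_poly_quad_rel L0 LK) /energy_rigid.
move=> /(_ (val v.1) (val v.2)) [].
  have inv X : F X == v -> energy (fun=> 1%N) X = val v.1 /\
      energy S X = val v.2.
    move=> /eqP <-; rewrite /= !inordK ?ltnS ?energy_bound //.
    have en0 w : (0 <= energy w X).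
      by apply: sumr_ge0 => k _; rewrite mulr_ge0 ?sqr_ge0.
    by rewrite !gez0_abs.
  by move=> X; rewrite !inE => /or4P[] /eqP ->; apply: inv.
by move=> E0 E2 E3; split; apply: val_inj.
Qed.

(** * Iteration over digits in a larger base *)

(** This makes [2 * K * B] a safe modulus for numbers below [B]: a relation modulo it holds over the
    integers. It is applied to the base [q], the modulus [m] and the spacing [g]. *)
Lemma quad_defect_lt (K B a b c d : nat) : (0 < K)%N ->
  (a < B)%N -> (b < B)%N -> (c < B)%N -> (d < B)%N ->
  `|K%:Z * (a%:Z - 2 * b%:Z + c%:Z) - (d%:Z - b%:Z)| < (2 * K * B)%:Z.
Proof.
case: B => [//|B]; rewrite !ltnS; case: K => [//|K] _ aB bB cB dB.
have Ka : (K * a <= K * B)%N by rewrite leq_mul2l aB orbT.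
have Kb : (K * b <= K * B)%N by rewrite leq_mul2l bB orbT.
have Kc : (K * c <= K * B)%N by rewrite leq_mul2l cB orbT.
rewrite (_ : 2 * K.+1 * B.+1 = 2 * (K * B) + 2 * K + 2 * B + 2)%N; last by nia.
rewrite (_ : _ - _ = (K * a)%N%:Z + (K * c)%N%:Z - (K * b)%N%:Z *+ 2 +
  (a%:Z + c%:Z - b%:Z - d%:Z)); last by rewrite !PoszM -(natz K.+1) -natr1 natz; ring.
move: (K * a)%N (K * b)%N (K * c)%N Ka Kb Kc => x y z *.
by lia.
Qed.

(* Solutions stay trivial digit by digit: the lowest digits form a solution
   modulo q, hence over the integers, so they agree and can be stripped off. *)
Lemma only_trivial_digits K Q q (T : finType) (f : T -> nat) n : (0 < K)%N ->
  (forall t, (f t < Q)%N) -> only_trivial K f -> (2 * K * Q <= q)%N ->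
  exists (Tn : finType) (fn : Tn -> nat),
  [/\ #|Tn| = (#|T| ^ n)%N, forall t, (fn t < q ^ n)%N & only_trivial K fn].
Proof.
move=> K0 fQ fK Qq; elim: n => [|n [Tn [fn [cardn fnq fnK]]]].
  exists unit, (fun=> 0%N); split=> [|//|]; first by rewrite card_unit.
  by move=> [] [] [] [].
exists (T * Tn)%type, (fun t => f t.1 + q * fn t.2)%N; split.
- by rewrite card_prod cardn expnS.
- move=> [t u] /=; have := fQ t; have := fnq u; rewrite expnS.
  move: (fn u) (f t) (q ^ n)%N => a b c ac bQ.
  have : (q * a.+1 <= q * c)%N by rewrite leq_mul2l ac orbT.
  have : (b < q)%N by nia.
  by lia.
move=> [t0 u0] [t1 u1] [t2 u2] [t3 u3]; rewrite /quad_rel /=.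
rewrite !PoszD !PoszM => rel.
have := fQ t0; have := fQ t1; have := fQ t2; have := fQ t3 => h3 h2 h1 h0.
have [] := @small_multiple_eq0 q%:Z
  (K%:Z * ((fn u0)%:Z - 2 * (fn u1)%:Z + (fn u2)%:Z) - ((fn u3)%:Z - (fn u1)%:Z))
  (K%:Z * ((f t0)%:Z - 2 * (f t1)%:Z + (f t2)%:Z) - ((f t3)%:Z - (f t1)%:Z)).
- by move: rel => /eqP; rewrite -subr_eq0 => /eqP <-; ring.
- by apply: lt_le_trans (quad_defect_lt _ _ _ _ _) _; rewrite ?lez_nat //.
move=> /subr0_eq /fnK[-> -> ->] /subr0_eq /fK[-> -> ->]; by [].
Qed.

(** * Fattening to residues modulo [m] *)

(** [F] marks intervals of length [w] starting at the points [g * f t], where [g = 2 * K * w] is too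
    wide for the offsets inside intervals to interfere. The value of [W] makes
    [2 * K * (g * Q) = W * w], which fits in [m]. The final inequality says that [y1] and [y2]
    differ by less than [w] modulo [m]. *)
Lemma fattened_set K Q m (T : finType) (f : T -> nat) :
  (0 < K)%N -> (forall t, (f t < Q)%N) -> only_trivial K f ->
  let W := (4 * K ^ 2 * Q)%N in let w := (m %/ W)%N in (W <= m)%N ->
  exists F : int -> bool,
  [/\ forall y, F (y + m%:Z) = F y,
      (\sum_(b < m) F b%:Z = #|T| * w)%N &
      forall y0 y1 y2 y3, F y0 -> F y1 -> F y2 -> F y3 ->
        quad_rel K y0 y1 y2 y3 -> ((y1 - y2 + w%:Z) %% m)%Z < 2 * w%:Z].
Proof.
move=> K0 fQ fK W w Wm.
have Ww : (W * w <= m)%N by rewrite mulnC leq_divM.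
pose g := (2 * K * w)%N.
pose sigma (p : T * 'I_w) := (p.2 + g * f p.1)%N.
have gQm : (2 * K * (g * Q) <= m)%N by apply: leq_trans Ww; rewrite /W /g; nia.
have w_le_g : (w <= g)%N by rewrite /g; nia.
have sigma_gQ p : (sigma p < g * Q)%N.
  case: p => t z; rewrite /sigma /=.
  have : (g * (f t).+1 <= g * Q)%N by rewrite leq_mul2l fQ orbT.
  by have := ltn_ord z; lia.
have sigma_m p : (sigma p < m)%N.
  by apply: (leq_trans (sigma_gQ p)); apply: leq_trans gQm; nia.
exists (fun y => [exists p, (y %% m)%Z == (sigma p)%:Z]); split.
- by move=> y; rewrite modzDr.
- have sigma_inj : injective (fun p => Ordinal (sigma_m p)).
    move=> [t z] [t' z'] [] /=; rewrite /sigma /= => E.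
    have [] := @small_multiple_eq0 g%:Z ((f t)%:Z - (f t')%:Z) (z%:Z - z'%:Z).
    + by move: E => /(congr1 Posz); rewrite !PoszD !PoszM; lia.
    + by have := ltn_ord z; have := ltn_ord z'; lia.
    move=> /subr0_eq [/(only_trivial_inj fK) ->] /subr0_eq [zz].
    by congr (_, _); apply: val_inj.
  transitivity #|[set Ordinal (sigma_m p) | p in [set: T * 'I_w]%SET]%SET|.
    rewrite -sum1_card [RHS]big_mkcond /=; apply: eq_bigr => b _.
    rewrite modz_small ?ltz_nat ?ltn_ord //.
    suff -> : [exists p, b%:Z == (sigma p)%:Z] =
      (b \in [set Ordinal (sigma_m p) | p in [set: T * 'I_w]%SET]%SET).
      by case: ifP.
    apply/existsP/imsetP => [[p /eqP[E]]|[p _ ->]].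
      by exists p; rewrite ?inE //; apply: val_inj.
    by exists p.
  by rewrite card_imset // cardsT card_prod card_ord.
move=> y0 y1 y2 y3.
move=> /existsP[[t0 z0] /eqP E0] /existsP[[t1 z1] /eqP E1].
move=> /existsP[[t2 z2] /eqP E2] /existsP[[t3 z3] /eqP E3].
rewrite /quad_rel (divz_eq y0 m) (divz_eq y1 m) (divz_eq y2 m) (divz_eq y3 m).
rewrite E0 E1 E2 E3.
move: (y0 %/ m)%Z (y1 %/ m)%Z (y2 %/ m)%Z (y3 %/ m)%Z => k0 k1 k2 k3 rel.
(* First the multiples of [m] are split off, then, in the same way, the multiples of [g]; what
   remains is the relation for [f]. *)
have [] := @small_multiple_eq0 m%:Z
  (K%:Z * (k0 - 2 * k1 + k2) - (k3 - k1))
  (K%:Z * ((sigma (t0, z0))%:Z - 2 * (sigma (t1, z1))%:Z + (sigma (t2, z2))%:Z)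
    - ((sigma (t3, z3))%:Z - (sigma (t1, z1))%:Z)).
- by move: rel => /eqP; rewrite -subr_eq0 => /eqP <-; ring.
- by apply: lt_le_trans (quad_defect_lt _ _ _ _ _) _; rewrite ?lez_nat //.
move=> _; rewrite /sigma /= !PoszD !PoszM => rel0.
have [] := @small_multiple_eq0 g%:Z
  (K%:Z * ((f t0)%:Z - 2 * (f t1)%:Z + (f t2)%:Z) - ((f t3)%:Z - (f t1)%:Z))
  (K%:Z * (z0%:Z - 2 * z1%:Z + z2%:Z) - (z3%:Z - z1%:Z)).
- by rewrite -[RHS]rel0 /g !PoszM; ring.
- by rewrite /g; apply: quad_defect_lt.
(* Only [t2 = t1] is kept: [y1] and [y2] lie in the same interval modulo [m]. *)
move=> /subr0_eq /fK[_ -> _] _.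
rewrite (_ : _ + w%:Z = (k1 - k2) * m%:Z + (z1%:Z - z2%:Z + w%:Z)); last by ring.
have w2 : (2 * w <= m)%N.
  by apply: leq_trans gQm; case: (Q) (fQ t0) => [//|n _]; clear -w_le_g K0; nia.
have z1w := ltn_ord z1; have z2w := ltn_ord z2.
by rewrite modzMDl modz_small; clear -w2 z1w z2w; lia.
Qed.

(** * Averaging over translates and counting points in an arc *)

Lemma sum_shift_periodic (F : int -> bool) (m y : nat) :
  (forall z, F (z + m%:Z) = F z) ->
  (\sum_(b < m) F (y%:Z + b%:Z)%R = \sum_(b < m) F b%:Z)%N.
Proof.
move=> Fm; elim: y => [|y <-]; first by apply: eq_bigr => b _; rewrite add0r.
have E z : (\sum_(b < m) F (z + b%:Z)%R = \sum_(0 <= b < m) F (z + b%:Z)%R)%N.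
  by rewrite big_mkord.
rewrite !E; case: m Fm {E} => [|m] Fm; first by rewrite !big_geq.
rewrite big_nat_recr //= big_nat_recl //= addnC addr0; congr (_ + _)%N.
  by congr nat_of_bool; rewrite -(Fm y%:Z); congr F; lia.
by apply: eq_bigr => b _; congr (nat_of_bool (F _)); lia.
Qed.

Lemma exists_ge_average (I : finType) (a : I -> nat) (S : nat) :
  (0 < #|I|)%N -> (\sum_i a i = S)%N -> exists i, (S <= a i * #|I|)%N.
Proof.
move=> /card_gt0P[i0 _] <-.
have [i _ imax] := @arg_maxnP I i0 xpredT a isT.
by exists i; rewrite mulnC -sum_nat_const; apply: leq_sum => j _; exact: imax.
Qed.

Lemma dvdz_gcd_quotient (m m' : nat) (e x : int) : (0 < m)%N ->
  m = (m' * gcdn `|e| m)%N -> (m%:Z %| e * x)%Z -> (m'%:Z %| x)%Z.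
Proof.
move=> m0 mE; rewrite !dvdzE /= abszM => mex.
have : (m %| gcdn `|e| m * `|x|)%N by rewrite muln_gcdl dvdn_gcd mex dvdn_mulr.
by rewrite {1}mE mulnC dvdn_pmul2l // gcdn_gt0 m0 orbT.
Qed.

(** With [g] the gcd, the residues have period [m / g] in [i], stay in one class modulo [g], and do
    not repeat within a period. Each of the [g] periods thus meets the arc at most [ceil(v / g)]
    times. *)
Lemma linear_in_arc_count (m : nat) (e c : int) (v : nat) : (0 < m)%N ->
  (#|[set i : 'I_m | (((e * i.+1%:Z + c) %% m)%Z < v%:Z)%R]%SET|
     <= v + gcdn `|e| m)%N.
Proof.
move=> m0; set S := [set _ | _]%SET.
have mz : m%:Z != 0 by rewrite eqz_nat -lt0n.
case: (posnP v) => [v0|v0].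
  rewrite (_ : S = finset.set0) ?cards0 //.
  by apply/setP => i; rewrite !inE v0; apply/negbTE; rewrite -leNgt modz_ge0.
pose g := gcdn `|e| m; have g0 : (0 < g)%N by rewrite gcdn_gt0 m0 orbT.
have [m' mE] : exists m', m = (m' * g)%N by apply/dvdnP; exact: dvdn_gcdr.
have m'0 : (0 < m')%N by move: m0; rewrite mE muln_gt0 => /andP[].
pose r (i : 'I_m) := `|((e * i.+1%:Z + c) %% m)%Z|%N.
have rE (i : 'I_m) : (r i)%:Z = ((e * i.+1%:Z + c) %% m)%Z.
  by rewrite /r gez0_abs // modz_ge0.
have quot_lt (i : 'I_m) : (i %/ m' < g)%N by rewrite ltn_divLR // mulnC -mE.
(* [h] records the period containing [i] and the block of length [g] containing its residue;
   [(v.-1 %/ g).+1] is [ceil(v / g)] for positive [v]. *)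
pose h (i : 'I_m) : 'I_g * 'I_(v.-1 %/ g).+1 :=
  (Ordinal (quot_lt i), inord (r i %/ g)%N).
have hinj : {in S &, injective h}.
  move=> i j; rewrite !inE -!rE !ltz_nat => iv jv [qij /(congr1 val) /=].
  have bd x : (x < v)%N -> (x %/ g < (v.-1 %/ g).+1)%N.
    by move=> xv; rewrite ltnS leq_div2r //; lia.
  rewrite !inordK ?bd // => rij.
  have rdiff : (m%:Z %| e * (i%:Z - j%:Z) - ((r i)%:Z - (r j)%:Z))%Z.
    have [qi Ei] : exists q, e * i.+1%:Z + c = q * m%:Z + (r i)%:Z.
      by eexists; rewrite rE; apply: divz_eq.
    have [qj Ej] : exists q, e * j.+1%:Z + c = q * m%:Z + (r j)%:Z.
      by eexists; rewrite rE; apply: divz_eq.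
    apply/dvdzP; exists (qi - qj).
    have -> : (qi - qj) * m%:Z =
        (qi * m%:Z + (r i)%:Z) - (qj * m%:Z + (r j)%:Z) - ((r i)%:Z - (r j)%:Z).
      by ring.
    by rewrite -Ei -Ej -!(natz _.+1) -!natr1 !natz; ring.
  have gdiff : (g%:Z %| (r i)%:Z - (r j)%:Z)%Z.
    have ge : (g%:Z %| e * (i%:Z - j%:Z))%Z.
      by rewrite dvdz_mulr // dvdzE dvdn_gcdl.
    have gm : (g%:Z %| m%:Z)%Z by rewrite dvdzE dvdn_gcdr.
    by have := rpredB ge (dvdz_trans gm rdiff); rewrite subKr.
  have rr : r i = r j.
    move: gdiff; rewrite -eqz_mod_dvd !modz_nat eqz_nat => /eqP modij.
    by rewrite (divn_eq (r i) g) (divn_eq (r j) g) rij modij.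
  move: rdiff; rewrite rr subrr subr0 => /(dvdz_gcd_quotient m0 mE).
  rewrite -eqz_mod_dvd !modz_nat eqz_nat => /eqP mij.
  by apply: val_inj; rewrite /= (divn_eq i m') (divn_eq j m') qij mij.
rewrite -(card_in_imset hinj) (leq_trans (max_card _)) // card_prod !card_ord.
rewrite mulnC mulSn addnC leq_add2r.
by apply: leq_trans (leq_pred v); apply: leq_divM.
Qed.

(** * Sets defined by squares modulo [N] and [N + 1] *)

Definition shift_fset (N : nat) (S : {set 'I_N}) : {fset int} :=
  [fset x in [seq (nat_of_ord i).+1%:Z | i <- enum S]]%fset.

Lemma mem_shift_fset N (S : {set 'I_N}) (x : int) :
  reflect (exists2 i, i \in S & x = i.+1%:Z) (x \in shift_fset S).
Proof.
rewrite !inE; apply: (iffP mapP) => [[i]|[i iS ->]].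
  by rewrite mem_enum => iS ->; exists i.
by exists i; rewrite ?mem_enum.
Qed.

Lemma card_shift_fset N (S : {set 'I_N}) : #|` shift_fset S| = #|S|.
Proof.
rewrite card_fseq undup_id ?size_map -?cardE //.
by rewrite map_inj_uniq ?enum_uniq // => i j [/val_inj].
Qed.

(* With [r = 2 h + 1] the four points are [x + d * {2 r, r - 1, 0, r (r + 1)}]. *)
Lemma quad_rel_squares (h : nat) (x d b : int) :
  quad_rel (2 * h ^ 2 + 2 * h + 1)
    ((x + d * (4 * h + 2)%:Z) ^+ 2 + b) ((x + d * (2 * h)%:Z) ^+ 2 + b)
    (x ^+ 2 + b) ((x + d * ((2 * h + 1) * (2 * h + 2))%:Z) ^+ 2 + b).
Proof. by rewrite /quad_rel !(PoszD, PoszM, expnS, expn0); ring. Qed.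

(** The difference of squares is [4 h d x] plus a constant, and the gcd of the slope with [m] is at
    most [4 h] times that of [d]. The hypotheses make both [2 w Q] and [4 h Q gcd(d, m)] at most
    [N / 2]. *)
Lemma squares_in_arc_count (h m N Q w : nat) (d : int) :
  (0 < h)%N -> (0 < N)%N -> (0 < m)%N -> (m <= N.+1)%N ->
  (4 * (2 * h ^ 2 + 2 * h + 1) ^ 2 * Q * w <= m)%N ->
  ((8 * h * Q) ^ 2 <= N)%N -> (gcdn `|d| m ^ 2 <= N)%N ->
  exists2 B : {fset int}, (#|` B| * Q <= N)%N &
    forall x : int, 1 <= x <= m%:Z ->
      (((x + d * (2 * h)%:Z) ^+ 2 - x ^+ 2 + w%:Z) %% m)%Z < 2 * w%:Z ->
      x \in B.
Proof.
move=> h0 N0 m0 mN wm hN gN.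
pose e := d * (4 * h)%:Z; pose c := (d * (2 * h)%:Z) ^+ 2 + w%:Z.
exists (shift_fset [set i : 'I_m |
  (((e * i.+1%:Z + c) %% m)%Z < (2 * w)%N%:Z)%R]%SET).
  rewrite card_shift_fset.
  have cnt := linear_in_arc_count e c (2 * w) m0.
  have ge : (gcdn `|e| m <= 4 * h * gcdn `|d| m)%N.
    apply: dvdn_leq; first by rewrite !muln_gt0 h0 gcdn_gt0 m0 orbT.
    by rewrite muln_gcdr dvdn_gcd abszM mulnC dvdn_gcdl dvdn_mull ?dvdn_gcdr.
  have gh : (8 * h * Q * gcdn `|d| m <= N)%N.
    by rewrite -leq_sqr expnMn -[(N ^ 2)%N]mulnn leq_mul.
  have Qw : (8 * (Q * w) <= N)%N.
    have : (16 * (Q * w) <= m)%N.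
      apply: leq_trans wm; rewrite -mulnA leq_mul2r; apply/orP; right.
      have : (2 ^ 2 <= (2 * h ^ 2 + 2 * h + 1) ^ 2)%N by rewrite leq_sqr; clear -h0; lia.
      by clear; lia.
    by move: mN N0; clear; lia.
  apply: (@leq_trans ((2 * w + 4 * h * gcdn `|d| m) * Q)).
    by rewrite leq_mul2r (leq_trans cnt) ?orbT // leq_add2l.
  by rewrite mulnDl; move: gh Qw; clear; lia.
move=> x xm arc; apply/mem_shift_fset.
have [n xE] : exists n, x = n.+1%:Z by exists `|x|.-1%N; clear -xm; lia.
have nm : (n < m)%N by clear -xm xE; lia.
exists (Ordinal nm) => //=; rewrite inE /= -xE.
rewrite (_ : e * x + c = (x + d * (2 * h)%:Z) ^+ 2 - x ^+ 2 + w%:Z) ?PoszM //.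
by rewrite /e /c !PoszM; ring.
Qed.

Lemma leq_double_mul_div (m d : nat) : (0 < d <= m)%N ->
  (m <= 2 * (d * (m %/ d)))%N.
Proof.
move=> /andP[d0 dm]; have := ltn_ceil m d0; have : (0 < m %/ d)%N by rewrite divn_gt0.
by move: (m %/ d)%N => q; nia.
Qed.

(** Averaging over pairs of translates gives density at least the square of [#|T| / (2 * W)], one
    factor per modulus, because [w1] and [w2] lose at most a factor 2 to rounding. *)
Lemma sparse_pattern_set (h Q N : nat) (T : finType) (f : T -> nat) :
  let K := (2 * h ^ 2 + 2 * h + 1)%N in
  (0 < h)%N -> (forall t, (f t < Q)%N) -> only_trivial K f -> (0 < Q)%N ->
  (4 * K ^ 2 * Q <= N)%N -> ((8 * h * Q) ^ 2 <= N)%N ->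
  exists A : {fset int},
  [/\ forall x, x \in A -> 1 <= x <= N%:Z,
      (N * #|T| ^ 2 <= #|` A| * (8 * K ^ 2 * Q) ^ 2)%N &
      forall d : int, d != 0 ->
      exists2 B : {fset int}, (#|` B| * Q <= N)%N &
        forall x : int, x \in A -> x + d * (2 * h)%:Z \in A ->
          x + d * (4 * h + 2)%:Z \in A ->
          x + d * ((2 * h + 1) * (2 * h + 2))%:Z \in A -> x \in B].
Proof.
move=> K h0 fQ fK Q0 WN hN.
have K0 : (0 < K)%N by rewrite /K addn1.
pose W := (4 * K ^ 2 * Q)%N.
have W0 : (0 < W)%N by rewrite !muln_gt0 K0 Q0.
have N0 : (0 < N)%N by apply: leq_trans WN.
have [F1 [F1p F1c F1s]] := @fattened_set K Q N T f K0 fQ fK WN.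
have [F2 [F2p F2c F2s]] := @fattened_set K Q N.+1 T f K0 fQ fK (leqW WN).
rewrite -/W in F1c F1s F2c F2s.
pose w1 := (N %/ W)%N; pose w2 := (N.+1 %/ W)%N.
rewrite -/w1 -/w2 in F1c F1s F2c F2s.
pose P (b : 'I_N * 'I_N.+1) (x : int) :=
  F1 (x ^+ 2 + b.1%:Z) && F2 (x ^+ 2 + b.2%:Z).
pose S b := [set i : 'I_N | P b i.+1%:Z]%SET.
(* For fixed [i], the translates run over a full period of each indicator, so the square itself does
   not matter. *)
have total : (\sum_b #|S b| = N * ((#|T| * w1) * (#|T| * w2)))%N.
  transitivity (\sum_(i < N) (\sum_(b1 < N) F1 (i.+1%:Z ^+ 2 + b1%:Z)%R) *
      (\sum_(b2 < N.+1) F2 (i.+1%:Z ^+ 2 + b2%:Z)%R))%N.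
    under [RHS]eq_bigr do rewrite big_distrlr pair_big /=.
    rewrite exchange_big /=; apply: eq_bigr => b _.
    rewrite -sum1_card big_mkcond /=; apply: eq_bigr => i _.
    by rewrite inE /P mulnb; case: ifP.
  rewrite -[in RHS](card_ord N) -sum_nat_const; apply: eq_bigr => i _.
  have sqE : i.+1%:Z ^+ 2 = (i.+1 ^ 2)%N%:Z by rewrite expr2 -PoszM mulnn.
  by rewrite sqE !sum_shift_periodic // F1c F2c.
have [|b] := exists_ge_average _ total; first by rewrite card_prod !card_ord muln_gt0 N0.
rewrite card_prod !card_ord => avg.
have w1N : (N <= 2 * (W * w1))%N by apply: leq_double_mul_div; rewrite W0 WN.
have w2N : (N.+1 <= 2 * (W * w2))%N.
  by apply: leq_double_mul_div; rewrite W0 (leqW WN).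
exists (shift_fset (S b)); split.
- by move=> x /mem_shift_fset[i _ ->]; have := ltn_ord i; clear; lia.
- rewrite card_shift_fset.
  have ww0 : (0 < w1 * w2)%N.
    by rewrite muln_gt0 !divn_gt0 // WN (leqW WN).
  rewrite -(leq_pmul2r ww0).
  apply: (@leq_trans (#|S b| * (N * N.+1))).
    by apply: leq_trans avg; rewrite -!mulnA leq_mul2l; apply/orP; right; nia.
  rewrite -mulnA leq_mul2l; apply/orP; right.
  apply: leq_trans (leq_mul w1N w2N) _; rewrite /W; clear; nia.
move=> d d0.
have inA x : x \in shift_fset (S b) -> P b x /\ 1 <= x <= N%:Z.
  move=> /mem_shift_fset[i]; rewrite inE => Pi ->; split=> //.
  by have := ltn_ord i; clear; lia.
(* If [|d|] is at least [N], the points [x] and [x + 2 h d] cannot both lie in [[N]]. *)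
case: (leqP N `|d|%N) => dN.
  exists fset0%fset; first by rewrite cardfs0.
  move=> x /inA[_ xN] /inA[_ x'N].
  have : (`|d| <= `|(d * (2 * h)%:Z)%R|)%N.
    by rewrite abszM leq_pmulr // muln_gt0 h0.
  by move: (d * _) x'N => y; clear -xN dN; lia.
(* The two gcds are coprime divisors of [d], so their product is at most [|d|]; hence one of them
   has square at most [N]. *)
have gg : (gcdn `|d| N * gcdn `|d| N.+1 <= N)%N.
  apply: leq_trans (ltnW dN); apply: dvdn_leq; first by rewrite lt0n absz_eq0.
  rewrite Gauss_dvd ?dvdn_gcdl //.
  by rewrite (coprime_dvdl (dvdn_gcdr _ _)) // (coprime_dvdr (dvdn_gcdr _ _)) ?coprimenS.
have [g1N|g1N] := leqP (gcdn `|d| N ^ 2) N.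
  have w1W : (W * w1 <= N)%N by rewrite mulnC leq_divM.
  have [B BQ Barc] := squares_in_arc_count h0 N0 N0 (leqnSn N) w1W hN g1N.
  exists B => // x /inA[/andP[x2 _] xN] /inA[/andP[x1 _] _] /inA[/andP[x0 _] _].
  move=> /inA[/andP[x3 _] _]; apply: Barc => //.
  have := F1s _ _ _ _ x0 x1 x2 x3 (quad_rel_squares _ _ _ _).
  by rewrite opprD addrACA subrr addr0.
have g2N : (gcdn `|d| N.+1 ^ 2 <= N)%N.
  rewrite leqNgt; apply/negP => g2N; have := ltn_mul g1N g2N.
  by rewrite -expnMn mulnn ltn_sqr ltnNge gg.
have w2W : (W * w2 <= N.+1)%N by rewrite mulnC leq_divM.
have [B BQ Barc] := squares_in_arc_count h0 N0 (ltn0Sn N) (leqnn _) w2W hN g2N.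
exists B => // x /inA[/andP[_ x2] xN] /inA[/andP[_ x1] _] /inA[/andP[_ x0] _].
move=> /inA[/andP[_ x3] _]; apply: Barc; first by clear -xN; lia.
have := F2s _ _ _ _ x0 x1 x2 x3 (quad_rel_squares _ _ _ _).
by rewrite opprD addrACA subrr addr0.
Qed.

(** * Choice of parameters *)

(** The point is that 14 does not depend on [s], so the ratio of the two exponents can be made as
    large as desired. One scale costs [q / #|T| <= L ^ 7], squared by the two moduli; the extra 5
    absorbs [(8 * K ^ 2) ^ 2]. *)
Lemma sparse_pattern_family (s : nat) : (0 < s)%N ->
  exists L h : nat, [/\ (1 < L)%N, (0 < h)%N &
  forall n, exists N0, forall N, (N0 <= N)%N ->
  exists A : {fset int},
  [/\ forall x, x \in A -> 1 <= x <= N%:Z,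
      (N <= #|` A| * L ^ (14 * n + 5))%N &
      forall d : int, d != 0 ->
      exists2 B : {fset int}, (#|` B| * L ^ (s * n) <= N)%N &
        forall x : int, x \in A -> x + d * (2 * h)%:Z \in A ->
          x + d * (4 * h + 2)%:Z \in A ->
          x + d * ((2 * h + 1) * (2 * h + 2))%:Z \in A -> x \in B]].
Proof.
move=> s0.
pose D := (s ^ (2 * s + 4)).+1.
(* Each summand is a constant to be absorbed by one factor [L]. Taking [L] a square and [h = 2 * l]
   gives [K = 8 * L + 4 * l + 1], between [3 * L] and [13 * L]. *)
pose l := (D ^ 2 + 2 * 13 ^ s.+1 + 64 * 13 ^ 4)%N.
pose L := (l ^ 2)%N; pose h := (2 * l)%N; pose K := (2 * h ^ 2 + 2 * h + 1)%N.
have l1 : (1 < l)%N.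
  have : (1 < 64 * 13 ^ 4)%N by [].
  by rewrite /l; move: (64 * _)%N => z; clear; lia.
have lL : (l <= L)%N by rewrite /L -mulnn leq_pmulr // ltnW.
have DL : (D ^ 2 <= L)%N by apply: leq_trans lL; rewrite /l -addnA leq_addr.
have tL : (2 * 13 ^ s.+1 <= L)%N.
  by apply: leq_trans lL; rewrite /l addnAC leq_addl.
have cL : (64 * 13 ^ 4 <= L)%N by apply: leq_trans lL; rewrite leq_addl.
have L1 : (1 < L)%N by apply: leq_trans lL.
have L0 := ltnW L1.
have K13 : (K <= 13 * L)%N by rewrite /K /L /h; clear -l1; nia.
have K3 : (3 * L <= K)%N by rewrite /K /L /h; clear -l1; nia.
have K0 : (0 < K)%N by apply: leq_trans K3; rewrite muln_gt0 L0.
have LK : (L <= K)%N by apply: leq_trans K3; rewrite leq_pmull.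
have := behrend_set s0 L0 K3; rewrite -/D => -[T [f [Tcard fK Ktriv]]].
clearbody D L.
pose q := (2 * K * K ^ s)%N.
have TL : (L ^ s <= #|T| * L ^ 5)%N.
  apply: (leq_trans Tcard); rewrite leq_mul2l expnMn -expnM (expnS L 4) leq_mul2r.
  by rewrite DL !orbT.
have T0 : (0 < #|T|)%N.
  by case: #|T| TL => //; rewrite mul0n leqn0 expn_eq0; case: (L) L0.
have qT : (q <= #|T| * L ^ 7)%N.
  apply: (@leq_trans (2 * (13 * L) ^ s.+1)).
    by rewrite /q -mulnA -expnS leq_mul2l leq_exp2r.
  apply: (@leq_trans (L * (L * L ^ s))); last first.
    by rewrite !expnS in TL *; move: (L ^ 0)%N TL => z; clear; nia.
  by rewrite expnMn mulnA (expnS L) leq_mul2r tL orbT.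
have qL : (L ^ s <= q)%N.
  apply: (@leq_trans (K ^ s)); first by rewrite leq_exp2r.
  by rewrite leq_pmull // muln_gt0.
have h0 : (0 < h)%N by rewrite muln_gt0 (ltnW l1).
exists L, h; split=> // n.
have [Tn [fn [cardn fnq fnK]]] := only_trivial_digits n K0 fK Ktriv (leqnn q).
have Q0 : (0 < q ^ n)%N.
  by rewrite expn_gt0 (leq_trans _ qL) // expn_gt0 L0.
exists (4 * K ^ 2 * q ^ n + (8 * h * q ^ n) ^ 2)%N => N N0N.
have [A [AN Acard Apat]] := sparse_pattern_set h0 fnq fnK Q0
  (leq_trans (leq_addr _ _) N0N) (leq_trans (leq_addl _ _) N0N).
exists A; split=> //.
  rewrite -/K cardn in Acard.
  have Tn0 : (0 < (#|T| ^ n) ^ 2)%N by rewrite !expn_gt0 T0.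
  rewrite -(leq_pmul2r Tn0); apply: (leq_trans Acard).
  rewrite -[leqRHS]mulnA leq_mul2l; apply/orP; right.
  rewrite expnMn expnMn -!expnM.
  apply: (@leq_trans (64 * (13 * L) ^ 4 * (#|T| * L ^ 7) ^ (n * 2))).
    apply: leq_mul; last by case: (n * 2)%N => // k; rewrite leq_exp2r.
    by rewrite leq_mul2l leq_exp2r.
  rewrite (expnMn 13) (expnMn #|T|) -(expnM L).
  rewrite (_ : 14 * n + 5 = 1 + 4 + 7 * (n * 2))%N; last by clear; lia.
  rewrite (expnD L (1 + 4)) (expnD L 1) expn1.
  move: (L ^ 4)%N (L ^ (7 * _))%N (#|T| ^ _)%N => a b e.
  move: (13 ^ 4)%N cL => X cL.
  apply: (@leq_trans (64 * X * (a * b * e))); first by clear; nia.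
  apply: leq_trans (leq_mul cL (leqnn (a * b * e))) _; clear; nia.
move=> d d0; have [B BQ Bpat] := Apat d d0; exists B => //.
apply: leq_trans BQ; rewrite leq_mul2l expnM; apply/orP; right.
by case: (n) => // k; rewrite leq_exp2r.
Qed.

(** * From powers of [L] to real densities *)

Lemma card_at_most_sub (R : realType) (S : set int) (B : {fset int}) (r : R) :
  (forall x, S x -> x \in B) -> #|` B|%:R <= r -> card_at_most S r.
Proof.
move=> SB Br; have finS : finite_set S.
  by apply: (@sub_finite_set _ _ [set` B]) => [x /SB|]; [|exact: finite_fset].
split=> //; apply: le_trans Br; rewrite ler_nat fsubset_leq_card //.
by rewrite -(set_fsetK B) -fset_set_sub.
Qed.

(** Consecutive intervals share an endpoint, as [14 * n + 19 = 14 * (n + 1) + 5], and the one for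
    [n = 1] ends at [L ^- 19]. *)
Lemma exists_scale (R : realType) (L : nat) (alpha : R) : (1 < L)%N ->
  0 < alpha < L%:R ^- 19 ->
  exists2 n, (0 < n)%N & L%:R ^- (14 * n + 19) <= alpha <= L%:R ^- (14 * n + 5).
Proof.
move=> L1 /andP[a0 a1].
have Lpos k : 0 < L%:R ^+ k :> R by rewrite exprn_gt0 // ltr0n ltnW.
have ex : exists k, L%:R ^- (14 * k + 5) <= alpha.
  have := archi_boundP (ltW (_ : 0 < alpha^-1)); rewrite invr_gt0 => /(_ a0).
  move: (Num.bound _) => b ab; exists b.
  rewrite invf_ple ?posrE //; apply: (le_trans (ltW ab)).
  rewrite -natrX ler_nat; apply: (@leq_trans (L ^ b)); first exact/ltnW/ltn_expl.
  by apply: leq_pexp2l; [exact: ltnW|clear; lia].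
have [k ka kmin] := ex_minnP ex.
have k2 : (1 < k)%N.
  rewrite ltnNge; apply/negP => k1; move: a1; rewrite ltNge => /negP; apply.
  apply: le_trans ka; rewrite lef_pV2 ?posrE // -!natrX ler_nat.
  by apply: leq_pexp2l; [exact: ltnW|clear -k1; lia].
exists k.-1; first by clear -k2; lia.
rewrite (_ : 14 * k.-1 + 19 = 14 * k + 5)%N ?ka /=; last by clear -k2; lia.
by rewrite leNgt; apply/negP => /ltW /kmin; clear -k2; lia.
Qed.

Theorem theorem5p1 (R : realType) (C : R) (C_gt0 : 0 < C) :
  exists (alpha0 : R) (a1 a2 a3 : int),
    [/\ 0 < alpha0 < 1, 0 < a1, 0 < a2, 0 < a3 &
      forall alpha : R, 0 < alpha < alpha0 ->
      let P : set int := [set 0; a1; a2; a3] in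
      \forall N \near \oo,
        exists A : set int,
          [/\ A `<=` int_range N,
              alpha * N%:R <= (#|` fset_set A|)%:R &
              forall d : int, d != 0 ->
                card_at_most [set x : int | affine_copy x d P `<=` A]
                  (alpha `^ C * N%:R)]].
Proof.
pose c := Num.bound C.
have Cc : C < c%:R by apply: archi_boundP; apply: ltW.
have c0 : (0 < c)%N by rewrite -(ltr_nat R); apply: lt_trans Cc.
(* The factor 33 is [14 + 19]: for positive [n], [(14 * n + 19) * c <= 33 * c * n]. *)
have [|L [h [L1 h0 family]]] := @sparse_pattern_family (33 * c).
  by rewrite muln_gt0.
have Lpos k : 0 < L%:R ^+ k :> R by rewrite exprn_gt0 // ltr0n ltnW.
exists (L%:R ^- 19), (2 * h)%:Z, (4 * h + 2)%:Z, ((2 * h + 1) * (2 * h + 2))%:Z.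
split; try by clear -h0; lia.
  by rewrite invr_gt0 Lpos /= invf_lt1 // exprn_egt1 // ltr1n.
move=> alpha alpha_lt P; have [n n0 /andP[an na]] := exists_scale L1 alpha_lt.
have /andP[alpha0 alpha1] := alpha_lt.
have alpha_le1 : alpha <= 1.
  by apply: (le_trans (ltW alpha1)); rewrite invf_le1 // exprn_ege1 // ler1n ltnW.
have [N0 sparse] := family n; near=> N.
have [|A [AN Acard Apat]] := sparse N; first by near: N; exact: nbhs_infty_ge.
exists [set` A]; rewrite set_fsetK; split.
- by move=> x /= /AN.
- apply: (@le_trans _ _ (L%:R ^- (14 * n + 5) * N%:R)); first by rewrite ler_wpM2r.
  by rewrite mulrC ler_pdivrMr // -natrX -natrM ler_nat.
move=> d d0; have [B BN Bpat] := Apat d d0.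
apply: (@card_at_most_sub _ _ B) => [x /= xA|].
  have inA t : P t -> x + d * t \in A by move=> Pt; apply: xA; exists t.
  apply: Bpat; [rewrite -[x]addr0 -(mulr0 d)| | |]; apply: inA; rewrite /P /=; tauto.
(* As [alpha <= 1] and [C < c], the integer power [alpha ^+ c] is the stronger bound. *)
apply: (@le_trans _ _ (alpha ^+ c * N%:R)); last first.
  rewrite ler_wpM2r // -powR_mulrn ?(ltW alpha0) //.
  by rewrite ger_powR ?alpha0 // ltW.
apply: (@le_trans _ _ (L%:R ^- (33 * c * n) * N%:R)).
  by rewrite mulrC ler_pdivlMr // -natrX -natrM ler_nat.
rewrite ler_wpM2r //.
apply: (@le_trans _ _ ((L%:R ^- (14 * n + 19)) ^+ c)); last first.
  by rewrite lerXn2r // ?nnegrE ?invr_ge0 ltW.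
rewrite exprVn -exprM lef_pV2 ?posrE // -!natrX ler_nat.
apply: leq_pexp2l; first exact: ltnW.
by rewrite mulnAC leq_mul2r; apply/orP; right; clear -n0; lia.
Unshelve. all: by end_near.
Qed.
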